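(* There is an absolute constant $c>0$ such that for every positive integer $N$, every real $\alpha>0$ and every set $\mathcal{A}\subset\{1,\dots,N\}$ with $|\mathcal{A}|=\alpha N$, we have $|\mathcal{A}/\mathcal{A}|\ge c\,\alpha^4N^2$.
   Context: Here $\mathcal{A}/\mathcal{A}=\{a/a' : a<a',\ a,a'\in\mathcal{A}\}$, a set of rational numbers.
   Formalization: The set A is assumed to have at least two elements; for a one-element A the set A/A (with a < a' strict) is empty, so the bound as stated fails, e.g. for N = 1, A = {1}, α = 1. *)

(* Defs.v *)
From mathcomp Require Import all_boot all_order all_algebra finmap.

Set Implicit Arguments.
Unset Strict Implicit.
Unset Printing Implicit Defensive.

Import Order.TTheory GRing.Theory Num.Theory.
Local Open Scope fset_scope.
Local Open Scope ring_scope.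

(* A/A = {a/a' : a < a', a, a' \in A}.  The quotients are taken in rat, so equal
   fractions such as 1/2 and 2/4 are counted once.  The inequality a < a' is
   strict, hence A/A is empty when A has fewer than two elements. *)
Definition quotient_set (A : {fset nat}) : {fset rat} :=
  [fset (a%:R / a'%:R : rat) | a in A, a' in [fset b in A | (a < b)%N]].

(* Main.v *)
(** The fractions a/a' coming from pairs with a prescribed gcd d are pairwise
    distinct, so each d accounts for at most |A/A| pairs.  Pairs with gcd larger
    than D number at most the sum of (N/d)^2 over d > D, hence at most N^2/D.
    With D of order alpha^-2 they are at most half of the roughly |A|^2/2 pairs
    a < a', and pigeonhole over the D remaining values of d concludes. *)
Require Import Defs.
From mathcomp Require Import all_boot all_order all_algebra finmap reals.
From mathcomp Require Import zify ring lra.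

Import Order.TTheory GRing.Theory Num.Theory.
Local Open Scope fset_scope.
Local Open Scope ring_scope.

(** Scaling a gcd by a factor gives [a * d = gcdn (a * a') (a * b') = gcdn (a' * a) (a' * b) = a' *
    d]. *)
Lemma eq_frac_gcdn (d a b a' b' : nat) :
  (0 < d)%N -> (0 < a)%N -> gcdn a b = d -> gcdn a' b' = d ->
  (a * b' = a' * b)%N -> a = a' /\ b = b'.
Proof.
move=> d_gt0 a_gt0 gab gab' eab.
have eqa : a = a'.
  apply/eqP; rewrite -(eqn_pmul2r d_gt0) -{1}gab' -gab.
  by rewrite !muln_gcdr eab (mulnC a a').
split=> //; apply/eqP; rewrite -(eqn_pmul2l a_gt0).
by rewrite {1}eqa eab.
Qed.

(** Telescoping: [1/(m+1)^2 <= 1/(m(m+1)) = 1/m - 1/(m+1)]. Keeping the negative term makes the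
    induction on [k] go through. *)
Lemma sum_inv_sqr_le (F : realFieldType) (D k : nat) : (0 < D)%N ->
  \sum_(D.+1 <= d < (D + k).+1) (d%:R ^+ 2)^-1 <= D%:R^-1 - (D + k)%:R^-1 :> F.
Proof.
move=> D_gt0; elim: k => [|k IHk]; first by rewrite addn0 big_geq // subrr.
rewrite addnS big_nat_recr /=; last by rewrite ltnS leq_addr.
set m := (D + k)%N in IHk *.
have m_gt0 : 0 < m%:R :> F by rewrite ltr0n addn_gt0 D_gt0.
move: m_gt0 IHk; move: m => m m_gt0 IHk.
suff step : (m.+1%:R ^+ 2)^-1 <= m%:R^-1 - m.+1%:R^-1 :> F.
  by apply: le_trans (lerD IHk step) _; rewrite addrA subrK.
have -> : m%:R^-1 - m.+1%:R^-1 = (m%:R * m.+1%:R)^-1 :> F.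
  by rewrite -natr1; field; rewrite natr1 pnatr_eq0 lt0r_neq0.
rewrite lef_pV2 ?posrE ?mulr_gt0 ?exprn_gt0 ?ltr0n -?(ltr0n F) //.
by rewrite expr2 ler_pM2r ?ltr0n // ler_nat.
Qed.

Lemma sum_divn_sqr_le (D N : nat) : (0 < D)%N ->
  (D * \sum_(D.+1 <= d < N.+1) (N %/ d) ^ 2 <= N ^ 2)%N.
Proof.
move=> D_gt0; have [ND|DN] := leqP N D; first by rewrite big_geq // muln0.
rewrite -(ler_nat rat) natrM natr_sum.
have D_pos : 0 < D%:R :> rat by rewrite ltr0n.
rewrite mulrC -ler_pdivlMr //.
apply: (@le_trans _ _ (\sum_(D.+1 <= d < N.+1) N%:R ^+ 2 * (d%:R ^+ 2)^-1)).
  rewrite big_nat_cond [leRHS]big_nat_cond; apply: ler_sum => d.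
  rewrite andbT => /andP[Dd _].
  have d_pos : 0 < d%:R :> rat by rewrite ltr0n (leq_trans _ Dd).
  rewrite ler_pdivlMr ?exprn_gt0 // -!natrX -natrM ler_nat -expnMn.
  by rewrite leq_sqr leq_trunc_div.
rewrite -mulr_sumr natrX ler_wpM2l ?exprn_ge0 //.
have := @sum_inv_sqr_le rat D (N - D) D_gt0; rewrite subnKC ?(ltnW DN) //.
by move=> /le_trans; apply; rewrite gerBl invr_ge0 ler0n.
Qed.

Lemma card_multiples_le (N d : nat) : (0 < d)%N ->
  (#|[set i : 'I_N.+1 | (0 < i)%N && (d %| i)%N]| <= N %/ d)%N.
Proof.
move=> d_gt0.
rewrite -[leqRHS]card_ord -cardsT.
apply: leq_trans (leq_imset_card (fun i : 'I_(N %/ d) => inord (i.+1 * d) : 'I_N.+1) _).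
apply/subset_leq_card/subsetP => i; rewrite inE => /andP[i_gt0 /dvdnP[q iq]].
have q_gt0 : (0 < q)%N by move: i_gt0; rewrite iq muln_gt0 => /andP[].
have qlt : (q.-1 < N %/ d)%N.
  by rewrite prednK // leq_divRL // -iq -ltnS ltn_ord.
apply/imsetP; exists (Ordinal qlt); rewrite ?inE //.
by apply/val_inj; rewrite /= prednK // -iq inordK.
Qed.

Section Counting.

Variables (N : nat) (A : {fset nat}).
Hypothesis A_bounds : forall a : nat, a \in A -> (1 <= a <= N)%N.

Let lt_pairs : {set 'I_N.+1 * 'I_N.+1} :=
  [set p : 'I_N.+1 * 'I_N.+1 | [&& val p.1 \in A, val p.2 \in A & (p.1 < p.2)%N]].

Let gcd_pairs (d : nat) : {set 'I_N.+1 * 'I_N.+1} :=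
  [set p : 'I_N.+1 * 'I_N.+1 | (p \in lt_pairs) && (gcdn p.1 p.2 == d)].

Lemma card_fset_ord : #|[set i : 'I_N.+1 | val i \in A]| = #|` A|.
Proof.
rewrite cardE -(size_map val); apply/perm_size/uniq_perm.
- by rewrite (map_inj_uniq val_inj) enum_uniq.
- exact: fset_uniq.
move=> a; apply/mapP/idP => [[i]|aA].
  by rewrite mem_enum inE => iA ->.
have aN : (a < N.+1)%N by have /andP[] := A_bounds _ aA.
by exists (Ordinal aN); rewrite // mem_enum inE.
Qed.

Lemma card_fset_le : (#|` A| <= N)%N.
Proof.
(* The elements of [A] are positive multiples of 1. *)
rewrite -card_fset_ord -[leqRHS]divn1; apply: leq_trans (card_multiples_le N 1 isT).
apply/subset_leq_card/subsetP => i; rewrite !inE => /A_bounds/andP[-> _].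
exact: dvd1n.
Qed.

(** The square of [A] is covered by the increasing pairs, their mirror images and the diagonal. *)
Lemma sqr_card_le_lt_pairs : (#|` A| ^ 2 <= 2 * #|lt_pairs| + #|` A|)%N.
Proof.
rewrite -card_fset_ord; set B := [set i | _].
rewrite -mulnn -cardsX mul2n -addnn.
pose swap (p : 'I_N.+1 * 'I_N.+1) := (p.2, p.1).
have cover_sub : setX B B \subset
    (lt_pairs :|: swap @: lt_pairs) :|: (fun i => (i, i)) @: B.
  apply/subsetP => -[i j]; rewrite !inE /= => /andP[iA jA].
  case: (ltngtP i j) => [ij|ji|/val_inj->]; first by rewrite iA jA.
    apply/orP; left; apply/orP; right.
    by apply/imsetP; exists (j, i); rewrite // inE /= jA iA.
  by apply/orP; right; apply/imsetP; exists j; rewrite // inE.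
apply: leq_trans (subset_leq_card cover_sub) _.
apply: leq_trans (leq_card_setU _ _) _; apply: leq_add; last exact: leq_imset_card.
apply: leq_trans (leq_card_setU _ _) _; rewrite leq_add2l; exact: leq_imset_card.
Qed.

Lemma card_gcd_pairs_le_quotient (d : nat) : (#|gcd_pairs d| <= #|` quotient_set A|)%N.
Proof.
pose frac (p : 'I_N.+1 * 'I_N.+1) : rat := (val p.1)%:R / (val p.2)%:R.
rewrite cardE -(size_map frac); apply: uniq_leq_size; last first.
  move=> _ /mapP[[i j] + ->]; rewrite mem_enum !inE /= => /andP[/and3P[iA jA ij] _].
  by apply/imfset2P; exists (val i) => //; exists (val j); rewrite // !inE /= jA ij.
rewrite map_inj_in_uniq ?enum_uniq // => -[i j] [i' j'].
rewrite !mem_enum !inE /= => /andP[/and3P[iA jA _] /eqP gij].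
move=> /andP[/and3P[_ j'A _] /eqP gij'] /eqP.
have /andP[i_gt0 _] := A_bounds _ iA.
have /andP[j_gt0 _] := A_bounds _ jA.
have /andP[j'_gt0 _] := A_bounds _ j'A.
have d_gt0 : (0 < d)%N by rewrite -gij gcdn_gt0 i_gt0.
rewrite /frac /= eqr_div ?pnatr_eq0 -?lt0n // -!natrM eqr_nat => /eqP eij.
by have [/val_inj-> /val_inj->] := eq_frac_gcdn _ _ _ _ _ d_gt0 i_gt0 gij gij' eij.
Qed.

(** Both coordinates of such a pair are positive multiples of [d] up to [N]. *)
Lemma card_gcd_pairs_le_divn (d : nat) : (0 < d)%N -> (#|gcd_pairs d| <= (N %/ d) ^ 2)%N.
Proof.
move=> d_gt0; pose M := [set i : 'I_N.+1 | (0 < i)%N && (d %| i)%N].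
apply: (@leq_trans #|setX M M|).
  apply/subset_leq_card/subsetP => -[i j].
  rewrite !inE /= => /andP[/and3P[/A_bounds/andP[-> _] /A_bounds/andP[-> _] _] /eqP<-].
  by rewrite dvdn_gcdl dvdn_gcdr.
by rewrite cardsX mulnn leq_sqr card_multiples_le.
Qed.

Lemma card_lt_pairs : #|lt_pairs| = (\sum_(1 <= d < N.+1) #|gcd_pairs d|)%N.
Proof.
have gcd0 : #|gcd_pairs 0| = 0%N.
  apply/eqP; rewrite cards_eq0 -subset0; apply/subsetP => -[i j].
  rewrite !inE /= => /andP[/and3P[/A_bounds/andP[i_gt0 _] _ _]].
  by rewrite -leqn0 leqNgt gcdn_gt0 i_gt0.
(* Adding the empty class [d = 0] lets the gcd be indexed by ['I_N.+1]; by [gcdlt] below, [inord]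
   never takes its default value there. *)
have -> : (\sum_(1 <= d < N.+1) #|gcd_pairs d| = \sum_(d < N.+1) #|gcd_pairs d|)%N.
  by rewrite big_ord_recl gcd0 add0n big_add1 big_mkord.
have gcdlt (p : 'I_N.+1 * 'I_N.+1) : p \in lt_pairs -> (gcdn p.1 p.2 < N.+1)%N.
  case: p => i j; rewrite inE /= => /and3P[/A_bounds/andP[i_gt0 iN] _ _].
  by rewrite ltnS (leq_trans (dvdn_leq i_gt0 (dvdn_gcdl i j))).
rewrite -sum1_card.
rewrite (partition_big (fun p : 'I_N.+1 * 'I_N.+1 => inord (gcdn p.1 p.2) : 'I_N.+1) xpredT) //=.
apply: eq_bigr => d _; rewrite -sum1_card; apply: eq_bigl => p.
rewrite [in RHS]inE; case pS: (p \in lt_pairs) => //=.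
by rewrite -val_eqE /= inordK // gcdlt.
Qed.

(** The gcd classes are split at [D]: the quotient set bounds each class up to [D], the tail sum
    bounds the rest. The factor [D] clears the denominator of [N^2/D]. *)
Lemma card_lt_pairs_le (D : nat) : (0 < D)%N ->
  (D * #|lt_pairs| <= D * (D * #|` quotient_set A|) + N ^ 2)%N.
Proof.
move=> D_gt0.
apply: leq_trans (leq_add (leqnn _) (sum_divn_sqr_le D N D_gt0)).
rewrite -mulnDr leq_mul2l card_lt_pairs; apply/orP; right.
have small K : (\sum_(1 <= d < K.+1) #|gcd_pairs d| <= K * #|` quotient_set A|)%N.
  rewrite -[K in (K * _)%N](subn1 K.+1) -sum_nat_const_nat.
  by apply: leq_sum => d _; apply: card_gcd_pairs_le_quotient.
have [ND|DN] := leqP N D.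
  by apply: leq_trans (small N) (leq_trans _ (leq_addr _ _)); rewrite leq_mul2r ND orbT.
rewrite (@big_cat_nat _ _ _ D.+1) //=; last by rewrite ltnS ltnW.
apply: leq_add (small D) _.
rewrite big_nat_cond [leqRHS]big_nat_cond; apply: leq_sum => d /andP[/andP[Dd _] _].
by apply: card_gcd_pairs_le_divn; apply: leq_trans Dd.
Qed.

Lemma card4_le_quotient : (2 <= #|` A|)%N ->
  (#|` A| ^ 4 <= 72 * N ^ 2 * #|` quotient_set A|)%N.
Proof.
move=> n_ge2; have := sqr_card_le_lt_pairs; have nN := card_fset_le.
(* Rounding up past [8 N^2 / n^2] makes the error [N^2] at most [D n^2 / 8]; since [n <= N], the
   extra 1 costs at most one more [N^2] in [D n^2]. *)
pose D := ((8 * N ^ 2) %/ (#|` A| ^ 2)).+1.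
have := card_lt_pairs_le D isT.
set n := #|` A| in n_ge2 nN D *; set Q := #|` _|; set P := #|lt_pairs|.
have n2_gt0 : (0 < n ^ 2)%N by rewrite expn_gt0 (leq_trans _ n_ge2).
have D_ge : (8 * N ^ 2 <= D * n ^ 2)%N by rewrite ltnW // ltn_ceil.
have D_le : (D * n ^ 2 <= 9 * N ^ 2)%N.
  by rewrite {1}/D [leqRHS]mulSn mulSn leq_add ?leq_sqr ?leq_trunc_div.
move=> DP nP.
(* As [n >= 2], the diagonal term [n] is at most [n^2 / 2] and is absorbed. *)
have n2P : (n ^ 2 <= 4 * P)%N by nia.
(* Four times the bound [DP] has error [4 N^2 <= D n^2 / 2], absorbed on the left. *)
have Dn2 : (D * n ^ 2 <= 8 * (D * (D * Q)))%N.
  have : (D * n ^ 2 <= D * (4 * P))%N by rewrite leq_mul2l n2P orbT.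
  lia.
have n2DQ : (n ^ 2 <= 8 * (D * Q))%N.
  by move: Dn2; rewrite (mulnCA 8) leq_pmul2l.
rewrite (_ : n ^ 4 = n ^ 2 * n ^ 2)%N; last by rewrite -expnD.
(* One factor [n^2] pairs with [D], so [n^4 <= 8 (D n^2) Q] and [72 = 8 * 9]. *)
apply: leq_trans (leq_mul (leqnn _) n2DQ) _.
rewrite (_ : _ * _ = 8 * (D * n ^ 2) * Q)%N; last by lia.
by rewrite leq_mul2r; apply/orP; right; lia.
Qed.

End Counting.

Theorem theorem5 (R : realType) :
  exists c : R, 0 < c /\
    forall (N : nat) (alpha : R) (A : {fset nat}),
      (0 < N)%N ->
      0 < alpha ->
      (forall a : nat, a \in A -> (1 <= a <= N)%N) ->
      (2 <= #|` A|)%N ->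
      (#|` A|)%:R = alpha * N%:R ->
      c * alpha ^+ 4 * N%:R ^+ 2 <= (#|` quotient_set A|)%:R.
Proof.
exists 72^-1; split; first by rewrite invr_gt0 ltr0n.
move=> N alpha A N_gt0 _ A_bounds A_ge2 cardA.
have := card4_le_quotient N A A_bounds A_ge2.
rewrite -(ler_nat R) natrX 2!natrM natrX cardA => bound.
have N2_gt0 : 0 < N%:R ^+ 2 :> R by rewrite exprn_gt0 // ltr0n.
(* Multiplying the goal by [72 N^2] turns its left side into [(alpha N)^4], the fourth power of the
   size of [A]. *)
rewrite -(ler_pM2r N2_gt0) -(@ler_pM2l _ 72) ?ltr0n //.
apply: le_trans (_ : (alpha * N%:R) ^+ 4 <= _); last by apply: le_trans bound _; lra.
by rewrite le_eqVlt; apply/orP; left; apply/eqP; field.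
Qed.
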